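(* Let $\alpha\in(0,1)$, $\lambda,\lambda_q>-1/2$, let $n,n_q$ be non-negative integers, $j\in\{0,\dots,n\}$, $t\in[0,1]$, and assume that $y\mapsto\hat G_j^{\lambda}\big(t(1-y^{1/\alpha})\big)$ is interpolated by shifted Gegenbauer polynomials in the variable $y$ at the $n_q+1$ shifted Gegenbauer-Gauss nodes with index $\lambda_q$. Let $\mathfrak T_{j,n_q}^{\lambda_q}(\eta)$ be the truncation error of the resulting quadrature approximation of $\int_0^1\hat G_j^{\lambda}\big(t(1-y^{1/\alpha})\big)\,dy$, with $\eta\in(0,1)$ the point in its representation given in the context. Then $\mathfrak T_{j,n_q}^{\lambda_q}(\eta)$ vanishes for all $j<n_q+1$, and there exist a $\lambda$-dependent constant $\nu_\lambda>0$, a $\lambda_q$-dependent constant $\rho_{\lambda_q}>1$, and a constant $\gamma_{n_q}^{\lambda}$ dependent on $n_q$ and $\lambda$, such that for all $j\ge n_q+1$ and all sufficiently large $n_q$, $$\left|\mathfrak T_{j,n_q}^{\lambda_q}(\eta)\right|\ \lesssim\ \eta^{\frac{n_q(1-\alpha)}{\alpha}}\,\Upsilon_{\rho_{\lambda_q}}(n_q)\begin{cases}\mu_{\lambda,\lambda_q}\,n_q^{\lambda_q-\lambda}\left(\dfrac{2t}{\alpha}\right)^{n_q},& j\sim n_q,\\[2mm] \dfrac{\gamma_{n_q}^{\lambda}\,j^{2(n_q+1)}}{\Theta_{\lambda_q}\,n_q^{3/2-\lambda_q}}\left(\dfrac{e\,t}{2\alpha n_q}\right)^{n_q},& j\gg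 n_q,\end{cases}$$ where $\mu_{\lambda,\lambda_q}=\nu_\lambda/\Theta_{\lambda_q}$, $\Theta_{\lambda_q}=\dfrac{\sqrt{2\pi}\,\Gamma(2\lambda_q+1)}{\Gamma(\lambda_q+1)}$, and $\Upsilon_{\rho_{\lambda_q}}(n_q)=1$ if $\lambda_q\ge0$, $\Upsilon_{\rho_{\lambda_q}}(n_q)=\rho_{\lambda_q}n_q^{-\lambda_q}$ if $-\tfrac12<\lambda_q<0$.
   Context: For $\lambda>-1/2$ the Gegenbauer polynomials $G_n^{\lambda}$ on $[-1,1]$ are orthogonal with respect to the weight $(1-x^2)^{\lambda-1/2}$ and normalized by $G_0^{\lambda}(x)=1$, $G_1^{\lambda}(x)=x$, $(n+2\lambda)G_{n+1}^{\lambda}(x)=2(n+\lambda)xG_n^{\lambda}(x)-nG_{n-1}^{\lambda}(x)$ for $n\ge1$ (so $G_n^\lambda(1)=1$). The shifted Gegenbauer polynomials on $[0,1]$ are $\hat G_n^{\lambda}(t)=G_n^{\lambda}(2t-1)$. $\hat K_{m}^{\lambda_q}$ is the leading coefficient of $\hat G_m^{\lambda_q}$. The shifted Gegenbauer-Gauss nodes with index $\lambda_q$ are the $n_q+1$ zeros in $(0,1)$ of $\hat G_{n_q+1}^{\lambda_q}$. The quadrature approximation of $\int_0^1g(y)\,dy$ is the integral over $[0,1]$ of the polynomial of degree at most $n_q$ interpolating $g$ at these nodes, and its truncation error is $\int_0^1g(y)\,dy$ minus this approximation. For $g(y)=\hat G_j^{\lambda}(t(1-y^{1/\alpha}))$ the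 truncation error is represented, with some $\eta\in(0,1)$, as $$\mathfrak T_{j,n_q}^{\lambda_q}(\eta)=\frac{(-1)^{n_q+1}\hat\chi_{j,n_q+1}^{\lambda}}{(n_q+1)!\,\hat K_{n_q+1}^{\lambda_q}}\left(\frac t\alpha\right)^{n_q+1}\eta^{\frac{(n_q+1)(1-\alpha)}{\alpha}}\hat G_{j-n_q-1}^{\lambda+n_q+1}\big(t(1-\eta^{1/\alpha})\big)\left(\int_0^1\hat G_{n_q+1}^{\lambda_q}(y)\,dy\right)\mathbb I_{j\ge n_q+1},$$ where $\hat\chi_{n,m}^{\lambda}=\frac{n!\,\Gamma(\lambda+1/2)\Gamma(n+m+2\lambda)}{(n-m)!\,\Gamma(n+2\lambda)\Gamma(m+\lambda+1/2)}$ for $n\ge m$ and $\mathbb I_{j\ge n_q+1}$ is $1$ if $j\ge n_q+1$ and $0$ otherwise. Notation: $a\lesssim b$ means $a\le(1+o(1))\,b$ as $n_q\to\infty$; $j\sim n_q$ means $j/n_q\to1$ (asymptotic equivalence) and $j\gg n_q$ means $j/n_q\to\infty$. *)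

(* Defs.v *)
From HB Require Import structures.
From mathcomp Require Import all_boot all_order all_algebra.
From mathcomp Require Import all_classical all_reals all_analysis.

Set Implicit Arguments.
Unset Strict Implicit.
Unset Printing Implicit Defensive.

Import Order.TTheory GRing.Theory Num.Theory.
Import numFieldNormedType.Exports.

Local Open Scope classical_set_scope.
Local Open Scope ring_scope.

Section Gegenbauer.
Context {R : realType}.
Implicit Types (l lq x alpha t eta : R) (n m j q : nat).

(* Euler's integral; every argument at which Gamma is used below is positive
   when l, lq > -1/2. *)
Definition Gamma x : R :=
  \int[lebesgue_measure]_(u in `]0, +oo[) (u `^ (x - 1) * expR (- u)).

Fixpoint gegenbauer l n : {poly R} :=
  match n with
  | 0 => 1
  | n'.+1 =>
    match n' with
    | 0 => 'X
    | n''.+1 =>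
      (n'%:R + 2 * l)^-1 *:
        ((2 * (n'%:R + l)) *: ('X * gegenbauer l n')
         - n'%:R *: gegenbauer l n'')
    end
  end.

Definition sgegenbauer l n : {poly R} := gegenbauer l n \Po (2 *: 'X - 1).

(* The factor 2^m coming from the affine change of variable is already
   contained in chi: (sgegenbauer l n)^`(m) = chi l n m *: sgegenbauer (l + m) (n - m). *)
Definition chi l n m : R :=
  n`!%:R * Gamma (l + 2^-1) * Gamma ((n + m)%:R + 2 * l)
  / ((n - m)`!%:R * Gamma (n%:R + 2 * l) * Gamma (m%:R + l + 2^-1)).

Definition gauss_nodes lq q (x : seq R) : Prop :=
  [/\ uniq x, size x = q.+1 &
      forall z, (z \in x) = (0 < z < 1) && root (sgegenbauer lq q.+1) z].

(* E is the integral of g over [0, 1] minus that of the polynomial of degree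
   at most q interpolating g at the q + 1 Gauss nodes of index lq. *)
Definition is_truncation_error lq q (g : R -> R) (E : R) : Prop :=
  exists (x : seq R) (p : {poly R}),
    [/\ gauss_nodes lq q x,
        (size p <= q.+1)%N,
        {in x, forall z, p.[z] = g z} &
        E = (\int[lebesgue_measure]_(y in `[0, 1]) g y)
            - (\int[lebesgue_measure]_(y in `[0, 1]) p.[y])].

Definition integrand alpha l t j (y : R) : R :=
  (sgegenbauer l j).[t * (1 - y `^ alpha^-1)].

(* For j < q + 1 the natural-number subtractions are truncated, but the
   indicator is then 0. *)
Definition truncT alpha l lq t j q eta : R :=
  (-1) ^+ q.+1 * chi l j q.+1
  / (q.+1`!%:R * lead_coef (sgegenbauer lq q.+1))
  * (t / alpha) ^+ q.+1
  * eta `^ (q.+1%:R * (1 - alpha) / alpha)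
  * (sgegenbauer (l + q.+1%:R) (j - q.+1)).[t * (1 - eta `^ alpha^-1)]
  * (\int[lebesgue_measure]_(y in `[0, 1]) (sgegenbauer lq q.+1).[y])
  * (q.+1 <= j)%N%:R.

Definition Theta lq : R :=
  Num.sqrt (2 * pi) * Gamma (2 * lq + 1) / Gamma (lq + 1).

Definition Upsilon lq (rho : R) q : R :=
  if 0 <= lq then 1 else rho * q%:R `^ (- lq).

Definition bound_sim (nu : R) alpha l lq t q : R :=
  nu / Theta lq * q%:R `^ (lq - l) * (2 * t / alpha) ^+ q.

Definition bound_gg (gam : R) alpha lq t j q : R :=
  gam * j%:R ^+ (2 * q.+1) / (Theta lq * q%:R `^ (3 / 2 - lq))
  * (expR 1 * t / (2 * alpha * q%:R)) ^+ q.

(* a q <= (1 + o(1)) b q as q -> oo, along the indices q satisfying P. *)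
Definition asymp_le_on (P : nat -> Prop) (a b : nat -> R) : Prop :=
  exists2 eps : nat -> R, eps @ \oo --> 0 &
    \forall q \near \oo, P q -> a q <= (1 + eps q) * b q.

End Gegenbauer.

(* Main.v *)
Require Import Defs.
From HB Require Import structures.
From mathcomp Require Import all_boot all_order all_algebra.
From mathcomp Require Import all_classical all_reals all_analysis.
From mathcomp Require Import measurable_realfun.
From mathcomp Require polyrcf.
From mathcomp Require Import ring lra.
Import Order.TTheory GRing.Theory Num.Theory.
Import numFieldNormedType.Exports.
Local Open Scope classical_set_scope.
Local Open Scope ring_scope.

(** The factor of the truncation error that involves [eta] and [t] separates
    from the rest: since [0 < eta < 1], the power
    [eta ^ ((q + 1) (1 - alpha) / alpha)] only decreases when [q + 1] is
    replaced by [q], and the Gegenbauer value at [t (1 - eta^(1/alpha))] is at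
    most 1 in absolute value.  What remains to be bounded, for [m = q + 1], is

      (chi_{j,m} / m!) * |I| * (t / alpha)^m / K,

    with [K] the leading coefficient and [I] the integral over [[0, 1]] of the
    shifted polynomial of degree [m] and index [lq].  Four facts suffice.

    - For [l >= 0], [|G_n| <= 1] on [[-1, 1]].  This is Sonin's argument:
      [N G^2 + (1 - x^2) G'^2], with [N = n (n + 2 l)], has derivative
      [4 l x G'^2], so it is largest at [-1] and [1], where it equals [N]
      ([gegenbauer_le1]).  The index used here is [l + m > 0].
    - [|I| <= |2 lq - 1|], from an explicit antiderivative of [G_n] as a
      combination of [G_(n+1)] and [G_(n-1)] ([Rintegral_sgegenbauer_le]).
    - [K >= c 3^q] for some [c > 0]: the ratio of consecutive leading
      coefficients tends to 4 ([lead_sgegenbauer_ge]).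
    - The functional equation of Gamma turns [chi_{j,m} / m!] into a binomial
      coefficient times a quotient of rising factorials ([chiE]).

    The asserted bounds leave exponential room, and polynomial factors and
    constants are absorbed in it.  When [j ~ q], [chi_{j,m} / m!] is
    [O(q (121/25)^q)] ([chi_le_geom]), whereas the target contains [2^q]
    against [((121/25) / 3)^q] and [121/75 < 2]; hence [nu = 1] works.
    When [j >> q], the bound
    [chi_{j,m} / m! <= (2 + 2 |l|)^m j^(2m) / (l + 1/2)] ([chi_le_pow]) fixes
    the constant [dominant_const], chosen so that the factor [(2 q)^q] in the
    denominator of the target disappears; the factor [e^q] then absorbs the
    rest.  As the factor Upsilon is at least 1 for [rho = 2], both
    inequalities hold eventually with no error term, and the factor
    [1 + o(1)] is taken to be 1. *)

(** * Euler's integral *)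
Section GammaTheory.
Context {R : realType}.
Local Notation mu := (@lebesgue_measure R).
Implicit Types (x u : R) (n : nat).

Definition gamma_density x u : R := u `^ (x - 1) * expR (- u).

(** Compact intervals exhausting the half-line, on which the density is
    continuous even when it blows up at 0; [n.+2] keeps the endpoints
    distinct. *)
Definition window n : set R := `[n.+2%:R^-1, n.+2%:R].

Lemma measurable_gamma_density x (A : set R) : measurable A ->
  measurable_fun A (fun u : R => (gamma_density x u)%:E : \bar R).
Proof.
move=> mA; apply/measurable_EFinP; apply: measurable_funTS.
apply: measurable_funM; first exact: measurable_powR.
by apply: measurableT_comp => //; exact: measurable_expR.
Qed.

Lemma gamma_density_ge0 x u : 0 <= gamma_density x u.
Proof. by rewrite mulr_ge0 ?powR_ge0 ?expR_ge0. Qed.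

Lemma bigcup_window : \bigcup_n window n = `]0%R, +oo[%classic.
Proof.
apply/seteqP; split=> u /=.
  move=> [n _]; rewrite /window /= !in_itv /= andbT => /andP[h _].
  by apply: lt_le_trans h; rewrite invr_gt0.
rewrite in_itv /= andbT => u0.
exists (Num.trunc (u^-1 + u)) => //=.
have h : u^-1 + u < (Num.trunc (u^-1 + u)).+2%:R.
  by rewrite (lt_trans (truncnS_gt _)) // ltr_nat.
rewrite /window /= in_itv /=; apply/andP; split.
  rewrite invf_ple ?posrE // ltW // (lt_trans _ h) //.
  by rewrite ltrDl.
by rewrite ltW // (lt_trans _ h) // ltrDr invr_gt0.
Qed.

Lemma window_nondecreasing : nondecreasing_seq window.
Proof.
move=> m n mn; apply/subsetPset => u; rewrite /window /= !in_itv /= => /andP[h1 h2].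
by rewrite (le_trans _ h1) ?lef_pV2 ?posrE ?ler_nat // (le_trans h2) ?ler_nat.
Qed.

Lemma window_lt n : n.+2%:R^-1 < n.+2%:R :> R.
Proof. by rewrite (@lt_trans _ _ 1) ?invf_lt1 ?ltr1n. Qed.

(** On each window only the elementary fundamental theorem of calculus is
    needed, whatever the behaviour at 0 and at infinity. *)
Lemma window_integral (f F : R -> R) n :
  (forall u, 0 < u -> is_derive u 1 F (f u)) ->
  (forall u, 0 < u -> {for u, continuous f}) ->
  (\int[mu]_(u in window n) (f u)%:E = (F n.+2%:R - F n.+2%:R^-1)%:E)%E.
Proof.
move=> dF cf.
have pos u : n.+2%:R^-1 <= u -> 0 < u by apply: lt_le_trans; rewrite invr_gt0.
have cF u : 0 < u -> {for u, continuous F}.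
  by move=> u0; apply/differentiable_continuous/derivable1_diffP; have [] := dF u u0.
rewrite EFinB; apply: continuous_FTC2.
- exact: window_lt.
- by apply: continuous_in_subspaceT => u; rewrite inE /window /= in_itv /= => /andP[/pos u0 _]; exact: cf.
- split.
  + by move=> u; rewrite in_itv /= => /andP[/ltW/pos u0 _]; have [] := dF u u0.
  + by apply: cvg_at_right_filter; apply: cF; rewrite invr_gt0.
  + by apply: cvg_at_left_filter; exact: cF.
- move=> u; rewrite in_itv /= => /andP[/ltW/pos u0 _].
  by rewrite derive1E; have [_ ->] := dF u u0.
Qed.

Lemma continuous_gamma_density x u : 0 < u -> {for u, continuous (gamma_density x)}.
Proof.
move=> u0; apply: continuousM.
  apply/differentiable_continuous/derivable1_diffP.
  by have [] := is_derive1_powR (x - 1) u0.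
by apply: continuous_comp; [exact: opp_continuous|exact: continuous_expR].
Qed.

Lemma integrable_gamma_density x n : mu.-integrable (window n) (EFin \o gamma_density x).
Proof.
apply: continuous_compact_integrable; first exact: segment_compact.
apply: continuous_in_subspaceT => u; rewrite inE /window /= in_itv /= => /andP[u0 _].
by apply: continuous_gamma_density; apply: lt_le_trans u0; rewrite invr_gt0.
Qed.

Lemma is_derive_expRN u (k : R) : is_derive u 1 (fun v => expR (- (k * v))) (- k * expR (- (k * u))).
Proof.
by apply: is_derive_eq; rewrite /GRing.scale /=; ring.
Qed.

(** Integrating this identity is the integration by parts behind the functional
    equation. *)
Lemma is_derive_powR_exp x u : 0 < u ->
  is_derive u 1 (fun v => v `^ x * expR (- v)) (x * gamma_density x u - gamma_density (x + 1) u).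
Proof.
move=> u0.
have h := is_derive1_powR x u0.
by apply: is_derive_eq; rewrite /GRing.scale /= /gamma_density addrK; ring.
Qed.

Local Open Scope ereal_scope.

Lemma cvg_window_integral x : \int[mu]_(u in window n) (gamma_density x u)%:E @[n --> \oo]
  --> \int[mu]_(u in `]0%R, +oo[) (gamma_density x u)%:E.
Proof.
rewrite -bigcup_window; apply: ge0_nondecreasing_set_cvg_integral.
- exact: window_nondecreasing.
- by move=> n; rewrite /window; exact: measurable_itv.
- by move=> n; apply: measurable_gamma_density; exact: measurable_itv.
- by move=> n u _; rewrite lee_fin gamma_density_ge0.
Qed.

(** Half of the exponential decay pays for any power: this gives both the
    vanishing of the boundary term at infinity and the convergence of the
    integral. *)
Lemma powR_le_expR x : (0 <= x)%R ->
  exists2 C : R, (0 <= C)%R & forall u, (0 < u -> u `^ x <= C * expR (u / 2))%R.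
Proof.
move=> x0; pose N := Num.trunc x.
exists (1 + 2 ^+ N.+1 * N.+1`!%:R)%R.
  by rewrite addr_ge0 // mulr_ge0 // exprn_ge0.
move=> u u0.
have e1 : (1 <= expR (u / 2))%R by rewrite -expR0 ler_expR divr_ge0 // ltW.
have [u1|u1] := leP u 1%R.
  apply: (@le_trans _ _ 1%R).
    by rewrite -(powRr0 u) ger_powR // u0.
  rewrite (le_trans e1) // ler_peMl ?expR_ge0 // lerDl.
  by rewrite mulr_ge0 ?exprn_ge0 ?expR_ge0.
apply: (@le_trans _ _ (u ^+ N.+1)%R).
  rewrite -powR_mulrn ?(ltW u0) // ler_powR ?(ltW u1) //.
  by rewrite ltW // truncnS_gt.
have u20 : (0 <= u / 2)%R by rewrite divr_ge0 // ltW.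
have h : ((u / 2) ^+ N.+1 / N.+1`!%:R <= expR (u / 2))%R.
  by rewrite (le_trans _ (expR_ge1Dxn N u20)) // lerDr.
have f0 : (0 < N.+1`!%:R :> R)%R by rewrite ltr0n fact_gt0.
rewrite ler_pdivrMr // expr_div_n ler_pdivrMr ?exprn_gt0 // in h.
apply: (le_trans h); rewrite mulrDl mul1r -mulrA mulrC [(_`!%:R * _)%R]mulrC.
by rewrite lerDr ltW // expR_gt0.
Qed.

Lemma cvg_half_exp : expR (- (2^-1 * n.+2%:R))%R @[n --> \oo] --> (0 : R)%R.
Proof.
have -> : (fun n => expR (- (2^-1 * n.+2%:R)))%R
    = (fun n => (expR (- 2^-1)) ^+ (n + 2))%R :> (nat -> R).
  by apply/funext => n; rewrite addn2 -expRM_natr mulNr.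
rewrite (cvg_shiftn 2 (fun n => expR (- 2^-1) ^+ n)%R).
by apply: cvg_expr; rewrite ger0_norm ?expR_ge0 // expR_lt1 oppr_lt0.
Qed.

(** The boundary terms of the integration by parts vanish in the limit. *)
Lemma cvg_boundary x : (0 < x)%R ->
  (n.+2%:R `^ x * expR (- n.+2%:R)
   - n.+2%:R^-1 `^ x * expR (- n.+2%:R^-1) : R)%R @[n --> \oo] --> (0 : R)%R.
Proof.
move=> x0; rewrite -[X in _ --> X](subr0 0%R); apply: cvgB.
  have [C C0 hC] := powR_le_expR _ (ltW x0).
  apply: (@squeeze_cvgr _ _ _ _ (cst 0%R) (fun n => C * expR (- (2^-1 * n.+2%:R)))%R).
  - near=> n; apply/andP; split; first by rewrite mulr_ge0 ?powR_ge0 ?expR_ge0.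
    rewrite (_ : - (2^-1 * n.+2%:R) = n.+2%:R / 2 + - n.+2%:R)%R; last by field.
    by rewrite expRD mulrA ler_wpM2r ?expR_ge0 // hC.
  - exact: cvg_cst.
  - rewrite -[X in _ --> X](mulr0 C); apply: cvgMl_tmp.
    exact: cvg_half_exp.
apply: (@squeeze_cvgr _ _ _ _ (cst 0%R) (fun n => n.+2%:R^-1 `^ x)%R).
- near=> n; apply/andP; split; first by rewrite mulr_ge0 ?powR_ge0 ?expR_ge0.
  by rewrite ler_piMr ?powR_ge0 // expR_le1 oppr_le0 invr_ge0.
- exact: cvg_cst.
- have /cvg_at_rightP := powR_cvg0 x0; apply; split=> [n|]; first by rewrite invr_gt0.
  have := @cvg_harmonic R; rewrite -(cvg_shiftn 1) => h.
  rewrite (_ : (fun n => _) = [sequence harmonic (n + 1)%N]_n) //.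
  by apply/funext => n; rewrite /harmonic /= addn1.
Unshelve. all: end_near. Qed.

(** Stated for extended reals, so that finiteness of one side can be deduced from
    finiteness of the other. *)
Lemma gamma_integralS x : (0 < x)%R ->
  \int[mu]_(u in `]0%R, +oo[) (gamma_density (x + 1) u)%:E
  = x%:E * \int[mu]_(u in `]0%R, +oo[) (gamma_density x u)%:E.
Proof.
move=> x0.
have win n : \int[mu]_(u in window n) (gamma_density (x + 1) u)%:E =
   x%:E * \int[mu]_(u in window n) (gamma_density x u)%:E
   - (n.+2%:R `^ x * expR (- n.+2%:R) - n.+2%:R^-1 `^ x * expR (- n.+2%:R^-1))%:E.
  have W : \int[mu]_(u in window n) (x * gamma_density x u - gamma_density (x + 1) u)%:E
    = (n.+2%:R `^ x * expR (- n.+2%:R) - n.+2%:R^-1 `^ x * expR (- n.+2%:R^-1))%:E.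
    apply: (@window_integral (fun u => x * gamma_density x u - gamma_density (x + 1) u)%R
       (fun u => u `^ x * expR (- u))%R) => u u0.
      exact: is_derive_powR_exp.
    apply: continuousB; last exact: continuous_gamma_density.
    by apply: continuousM; [exact: cst_continuous|exact: continuous_gamma_density].
  rewrite -W.
  have mD : measurable (window n) by exact: measurable_itv.
  have I1 := integrable_gamma_density x n; have I2 := integrable_gamma_density (x + 1) n.
  have F1 : \int[mu]_(u in window n) (gamma_density x u)%:E \is a fin_num by exact: integrable_fin_num.
  have F2 : \int[mu]_(u in window n) (gamma_density (x + 1) u)%:E \is a fin_num by exact: integrable_fin_num.
  under [X in _ = _ - X]eq_integral do rewrite EFinB EFinM.
  rewrite integralB //; last exact: integrableZl.
  rewrite integralZl //.
  rewrite -(fineK F1) -(fineK F2) -EFinM -!EFinB; congr _%:E; ring.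
have l1 := cvg_window_integral (x + 1).
have l2 : (fun n => \int[mu]_(u in window n) (gamma_density (x + 1) u)%:E) @ \oo -->
  x%:E * \int[mu]_(u in `]0%R, +oo[) (gamma_density x u)%:E - 0%:E.
  under eq_fun do rewrite win.
  apply: cvgeB.
  - by rewrite fin_num_adde_defl.
  - by apply: cvgeZl => //; exact: cvg_window_integral.
  - by apply: cvg_EFin; [exact: nearW|exact: cvg_boundary].
by have := cvg_unique _ l1 l2; rewrite sube0; apply.
Qed.

Lemma gamma_integral_lty x : (1 <= x)%R ->
  \int[mu]_(u in `]0%R, +oo[) (gamma_density x u)%:E < +oo.
Proof.
move=> x1.
have [C C0 hC] : exists2 C : R, (0 <= C)%R & forall u, (0 < u -> u `^ (x - 1) <= C * expR (u / 2))%R.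
  by apply: powR_le_expR; rewrite subr_ge0.
apply: (@le_lt_trans _ _ (C * 2)%:E); last exact: ltry.
apply: (cvge_to_le (cvg_window_integral x)); apply: nearW => n.
apply: (@le_trans _ _ (\int[mu]_(u in window n) (C * expR (- (2^-1 * u)))%:E)).
  have mD : measurable (window n) by exact: measurable_itv.
  apply: ge0_le_integral => //.
  - by move=> u _; rewrite lee_fin gamma_density_ge0.
  - exact: measurable_gamma_density.
  - apply/measurable_EFinP; apply: measurable_funTS; apply: continuous_measurable_fun.
    move=> u; apply: cvgMl_tmp; apply: continuous_comp; last exact: continuous_expR.
    by apply: cvgN; apply: cvgMl_tmp; exact: cvg_id.
  - move=> u; rewrite /window /= in_itv /= => /andP[u0 _].
    have {}u0 : (0 < u)%R by apply: lt_le_trans u0; rewrite invr_gt0.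
    rewrite lee_fin /gamma_density (_ : - (2^-1 * u) = u / 2 + - u)%R; last by field.
    by rewrite expRD mulrA ler_wpM2r ?expR_ge0 // hC.
have -> : \int[mu]_(u in window n) (C * expR (- (2^-1 * u)))%:E
  = (- 2 * C * expR (- (2^-1 * n.+2%:R))
     - - 2 * C * expR (- (2^-1 * n.+2%:R^-1)))%:E.
  apply: (@window_integral (fun u => C * expR (- (2^-1 * u)))%R
     (fun u => - 2 * C * expR (- (2^-1 * u)))%R) => u u0.
    have h := is_derive_expRN u 2^-1.
    by apply: is_derive_eq; rewrite /GRing.scale /=; field.
  apply: cvgMl_tmp; apply: continuous_comp; last exact: continuous_expR.
  by apply: cvgN; apply: cvgMl_tmp; exact: cvg_id.
rewrite lee_fin.
have := expR_gt0 (- (2^-1 * n.+2%:R) : R)%R.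
have : (expR (- (2^-1 * n.+2%:R^-1)) <= 1 :> R)%R.
  by rewrite expR_le1 oppr_le0 mulr_ge0 // invr_ge0.
move: C0; nra.
Qed.

Lemma gamma_integral_gt0 x : (0 < x)%R ->
  0 < \int[mu]_(u in `]0%R, +oo[) (gamma_density x u)%:E.
Proof.
move=> x0.
pose c : R := (2^-1 * expR (- 2))%R.
have c0 : (0 < c)%R by rewrite mulr_gt0 ?expR_gt0.
apply: (@lt_le_trans _ _ (\int[mu]_(u in `[1%R, 2%R]) c%:E)).
  rewrite integral_cst //= lebesgue_measure_itv /= lte_fin ltr1n.
  by rewrite -EFinD -EFinM lte_fin mulr_gt0 // subr_gt0 ltr1n.
apply: (@le_trans _ _ (\int[mu]_(u in `[1%R, 2%R]) (gamma_density x u)%:E)).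
  apply: ge0_le_integral => //.
  - by move=> u _; rewrite lee_fin ltW.
  - exact: measurable_gamma_density.
  - move=> u; rewrite /= in_itv /= => /andP[u1 u2].
    have u0 : (0 < u)%R by rewrite (lt_le_trans _ u1).
    rewrite lee_fin /c /gamma_density ler_pM ?expR_ge0 //.
      apply: (@le_trans _ _ (u `^ (- 1))%R).
        by rewrite powR_inv1 ?(ltW u0) // lef_pV2 ?posrE.
      by rewrite ler_powR // lerBrDl subrr ltW.
    by rewrite ler_expR lerN2.
apply: ge0_subset_integral => //.
- exact: measurable_gamma_density.
- by move=> u _; rewrite lee_fin gamma_density_ge0.
- by move=> u; rewrite /= !in_itv /= andbT => /andP[u1 _]; rewrite (lt_le_trans _ u1).
Qed.

Local Close Scope ereal_scope.

(** For [x < 1] the density is unbounded at 0; finiteness is pulled back from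
    [x + 1] through the functional equation. *)
Lemma gamma_integral_fin x : 0 < x ->
  (\int[mu]_(u in `]0%R, +oo[) (gamma_density x u)%:E)%E \is a fin_num.
Proof.
move=> x0; rewrite ge0_fin_numE; last exact/ltW/gamma_integral_gt0.
have := @gamma_integral_lty (x + 1); rewrite lerDr ltW // => /(_ isT).
rewrite gamma_integralS //.
have := gamma_integral_gt0 _ x0.
case: (\int[mu]_(u in _) _)%E => [r _ _| _|//]; first exact: ltry.
by rewrite gt0_muley.
Qed.

Lemma Gamma_gt0 x : 0 < x -> 0 < Gamma x.
Proof.
move=> x0; rewrite /Gamma /Rintegral fine_gt0 // gamma_integral_gt0 //=.
by rewrite -ge0_fin_numE ?gamma_integral_fin //; exact/ltW/gamma_integral_gt0.
Qed.

Lemma GammaS x : 0 < x -> Gamma (x + 1) = x * Gamma x.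
Proof.
move=> x0; rewrite /Gamma /Rintegral gamma_integralS // fineM //.
exact: gamma_integral_fin.
Qed.

End GammaTheory.

(** * Gegenbauer polynomials *)

(** Certificates for equalities that are linear combinations of hypotheses: the
    last premise is a polynomial identity. *)
Lemma lincomb1 (S : comPzRingType) (a b p q c : S) :
  p = q -> a - b = c * (p - q) -> a = b.
Proof. by move=> ->; rewrite subrr mulr0 => /subr0_eq. Qed.

Lemma lincomb2 (S : comPzRingType) (a b p q p' q' c c' : S) :
  p = q -> p' = q' -> a - b = c * (p - q) + c' * (p' - q') -> a = b.
Proof. by move=> -> ->; rewrite !subrr !mulr0 addr0 => /subr0_eq. Qed.

Lemma lincomb3 (S : comPzRingType) (a b p q p' q' p'' q'' c c' c'' : S) :
  p = q -> p' = q' -> p'' = q'' ->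
  a - b = c * (p - q) + c' * (p' - q') + c'' * (p'' - q'') -> a = b.
Proof. by move=> -> -> ->; rewrite !subrr !mulr0 !addr0 => /subr0_eq. Qed.

Lemma deriv_natr (S : nzRingType) n : (n%:R : {poly S})^`() = 0.
Proof. by rewrite -polyC_natr derivC. Qed.

Lemma horner_natr (S : nzRingType) n (x : S) : (n%:R : {poly S}).[x] = n%:R.
Proof. by rewrite -polyC_natr hornerC. Qed.

Section GegenbauerTheory.
Context {R : realType}.
Variable l : R.
Hypothesis l_gt : - 2^-1 < l.
Local Notation G := (gegenbauer l).
Local Notation L := (l%:P : {poly R}).

Lemma succD2l_gt0 n : 0 < n.+1%:R + 2 * l.
Proof.
by have : (0 : R) <= n%:R by []; rewrite -natr1; move: l_gt; set a := n%:R; lra.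
Qed.

Lemma succD2l_neq0 n : (n.+1%:R + 2 * L != 0).
Proof.
have -> : n.+1%:R + 2 * L = (n.+1%:R + 2 * l)%:P by rewrite (polyCD n.+1%:R) polyCM !polyC_natr.
by rewrite polyC_eq0 gt_eqF // succD2l_gt0.
Qed.

Lemma gegenbauerSS n : G n.+2 = (n.+1%:R + 2 * l)^-1 *:
  ((2 * (n.+1%:R + l)) *: ('X * G n.+1) - n.+1%:R *: G n).
Proof. by []. Qed.

Lemma gegenbauer_rec n :
  (n.+1%:R + 2 * L) * G n.+2
  = 2 * (n.+1%:R + L) * ('X * G n.+1) - n.+1%:R * G n.
Proof.
have -> : n.+1%:R + 2 * L = (n.+1%:R + 2 * l)%:P by rewrite (polyCD n.+1%:R) polyCM !polyC_natr.
rewrite mul_polyC gegenbauerSS scalerA mulfV ?gt_eqF ?succD2l_gt0 // scale1r.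
by rewrite -!mul_polyC polyCM (polyCD n.+1%:R) !polyC_natr.
Qed.

Lemma gegenbauer_deriv_rec n :
  (n.+1%:R + 2 * L) * (G n.+2)^`()
  = 2 * (n.+1%:R + L) * (G n.+1 + 'X * (G n.+1)^`()) - n.+1%:R * (G n)^`().
Proof.
have := congr1 (fun p => p^`()) (gegenbauer_rec n).
rewrite !(deriv_natr, derivM, derivD, derivN, derivX, derivC).
by move=> h; apply: (lincomb1 _ _ _ _ _ 1 h); ring.
Qed.

(** The three relations are proved together because each of them, for [n + 1],
    rests on the others.  The third one follows from the other two only after
    division by [n + 2 l], which may vanish for [n = 0]; carrying it along
    confines the division to positive [n]. *)
Lemma gegenbauer_deriv n :
  [/\ (n%:R + 2 * L) * (G n.+1)^`()
        = n.+1%:R * ((n%:R + 2 * L) * G n + 'X * (G n)^`()),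
      (n%:R + 2 * L) * ('X * (G n.+1)^`() - n.+1%:R * G n.+1)
        = n.+1%:R * (G n)^`() &
      (1 - 'X ^+ 2) * (G n.+1)^`() = n.+1%:R * (G n - 'X * G n.+1)].
Proof.
elim: n => [|n [An Bn Dn]].
  by rewrite /= derivX -[1]/(1%:P) derivC; split; ring.
have rec := gegenbauer_rec n; have drec := gegenbauer_deriv_rec n.
have nz := succD2l_neq0 n.
have e (k : nat) : (k.+1)%:R = k%:R + 1 :> {poly R} by rewrite -natr1.
move: An Bn Dn rec drec nz; rewrite !(e n.+1, e n).
set x := 'X. set g2 := G n.+2. set g1 := G n.+1. set g0 := G n.
set d2 := g2^`(). set d1 := g1^`(). set d0 := g0^`().
move: (n%:R : {poly R}) => k An Bn Dn rec drec nz.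
have A1 : (k + 1 + 2 * L) * d2 = (k + 1 + 1) * ((k + 1 + 2 * L) * g1 + x * d1).
  by apply: (lincomb2 _ _ _ _ _ _ _ 1 1 drec Bn); ring.
have B1 : (k + 1 + 2 * L) * (x * d2 - (k + 1 + 1) * g2) = (k + 1 + 1) * d1.
  by apply: (lincomb3 _ _ _ _ _ _ _ _ _ x (- (k + 2)) (- (k + 2)) A1 rec Dn); ring.
split=> //.
apply: (mulfI nz).
by apply: (lincomb2 _ _ _ _ _ _ _ 1 (- x) A1 B1); ring.
Qed.

Lemma gegenbauer_at1 n : (G n).[1] = 1.
Proof.
suff: (G n).[1] = 1 /\ (G n.+1).[1] = 1 by case.
elim: n => [|n [IH0 IH1]]; first by rewrite /= hornerX hornerC.
split=> //; rewrite gegenbauerSS !(hornerZ, hornerD, hornerN, hornerM, hornerX) IH0 IH1.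
have := succD2l_gt0 n; rewrite -natr1 => h.
by field; apply: lt0r_neq0; move: h; lra.
Qed.

Lemma gegenbauer_atN1 n : (G n).[-1] = (-1) ^+ n.
Proof.
suff: (G n).[-1] = (-1) ^+ n /\ (G n.+1).[-1] = (-1) ^+ n.+1 by case.
elim: n => [|n [IH0 IH1]]; first by rewrite /= hornerX hornerC expr0 expr1.
split=> //; rewrite gegenbauerSS !(hornerZ, hornerD, hornerN, hornerM, hornerX) IH0 IH1 !exprS.
have := succD2l_gt0 n; rewrite -natr1 => h.
by field; apply: lt0r_neq0; move: h; lra.
Qed.

(** Both [G_(n+2)'] and [G_n'] are combinations of [G_(n+1)] and [X G_(n+1)'];
    the coefficients are such that [X G_(n+1)'] cancels. *)
Lemma gegenbauer_antideriv n :
  2 * (n.+1%:R + L) * n.+2%:R * (n%:R + 2 * L) * G n.+1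
  = ((n%:R + 2 * L) * (n.+1%:R + 2 * L) * G n.+2
     - n.+1%:R * n.+2%:R * G n)^`().
Proof.
rewrite !(deriv_natr, derivM, derivD, derivN, derivX, derivC).
have [_ B0 _] := gegenbauer_deriv n.
have [A1 _ _] := gegenbauer_deriv n.+1.
move: A1 B0; rewrite -!natr1 => A1 B0.
apply: (lincomb2 _ _ _ _ _ _ _ (- (n%:R + 2 * L)) (- (n%:R + 2)) A1 B0); ring.
Qed.

Lemma gegenbauer_ode n :
  (1 - 'X ^+ 2) * (G n.+1)^`()^`()
  = (2 * L + 1) * ('X * (G n.+1)^`())
    - n.+1%:R * (n.+1%:R + 2 * L) * G n.+1.
Proof.
have [_ Bn Dn] := gegenbauer_deriv n.
have := congr1 (fun p => p^`()) Dn.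
rewrite !(expr2, deriv_natr, derivM, derivD, derivN, derivX, derivC).
move=> D'; apply: (lincomb2 _ _ _ _ _ _ _ 1 (-1) D' Bn).
by rewrite -(natr1 n); ring.
Qed.

(** Sonin's function: it dominates a multiple of [G^2] on [[-1, 1]] and agrees
    with it at both endpoints. *)
Definition sonin n : {poly R} :=
  (n.+1%:R * (n.+1%:R + 2 * L)) * (G n.+1) ^+ 2
  + (1 - 'X ^+ 2) * (G n.+1)^`() ^+ 2.

(** By the differential equation, the derivative has the sign of [l X]. *)
Lemma deriv_sonin n : (sonin n)^`() = (4 * L) * ('X * (G n.+1)^`() ^+ 2).
Proof.
rewrite /sonin !(expr2, deriv_natr, derivM, derivD, derivN, derivX, derivC).
apply: (lincomb1 _ _ _ _ _ (2 * (G n.+1)^`()) (gegenbauer_ode n)); ring.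
Qed.

(** Sonin's function increases on [[0, 1]] and decreases on [[-1, 0]], so it is
    bounded by its common value [N] at the endpoints. *)
Lemma gegenbauer_le1 n (x : R) : 0 <= l -> -1 <= x <= 1 -> `|(G n).[x]| <= 1.
Proof.
move=> l0 /andP[x_ge x_le].
case: n => [|n]; first by rewrite /= hornerC normr1.
pose N : R := n.+1%:R * (n.+1%:R + 2 * l).
have N_gt0 : 0 < N by rewrite mulr_gt0 ?succD2l_gt0.
have soninE y : (sonin n).[y]
    = N * (G n.+1).[y] ^+ 2 + (1 - y ^+ 2) * (G n.+1)^`().[y] ^+ 2.
  by rewrite /sonin /N !expr2 !(horner_natr, hornerM, hornerD, hornerN, hornerX, hornerC).
have derE y : (sonin n)^`().[y] = 4 * l * (y * (G n.+1)^`().[y] ^+ 2).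
  by rewrite deriv_sonin !expr2 !(horner_natr, hornerM, hornerX, hornerC).
have sonin1 : (sonin n).[1] = N.
  by rewrite soninE gegenbauer_at1 expr1n subrr mul0r addr0 mulr1.
have soninN1 : (sonin n).[-1] = N.
  by rewrite soninE gegenbauer_atN1 sqrrN expr1n subrr mul0r addr0 sqrr_sign mulr1.
have Sx : (sonin n).[x] <= N.
  have [x0|x0] := leP 0 x.
    rewrite -sonin1; apply: (@polyrcf.ler_hornerW _ 0 1) => //.
    - move=> y; rewrite in_itv /= => /andP[y0 _].
      rewrite derE; do 2?apply: mulr_ge0 => //; first exact: ltW.
      exact: sqr_ge0.
    - by rewrite in_itv /= x0.
    - by rewrite in_itv /= ler01 lexx.
  rewrite -soninN1 -lerN2 -!hornerN.
  apply: (@polyrcf.ler_hornerW _ (-1) 0) => //.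
  - move=> y; rewrite in_itv /= => /andP[_ y0].
    rewrite derivN hornerN derE -mulrN -mulNr; do 2?apply: mulr_ge0 => //.
      by rewrite oppr_ge0 ltW.
    exact: sqr_ge0.
  - by rewrite in_itv /= lexx lerN10.
  - by rewrite in_itv /= x_ge ltW.
have : N * (G n.+1).[x] ^+ 2 <= N * 1.
  rewrite mulr1 (le_trans _ Sx) // soninE lerDl mulr_ge0 ?sqr_ge0 //.
  by rewrite expr2; nra.
rewrite ler_pM2l // => h.
by rewrite -(@expr_le1 _ 2) // -normrX ger0_norm ?sqr_ge0.
Qed.

Lemma sgegenbauer_le1 n (x : R) : 0 <= l -> 0 <= x <= 1 -> `|(sgegenbauer l n).[x]| <= 1.
Proof.
move=> l0 /andP[x0 x1]; rewrite /sgegenbauer horner_comp; apply: gegenbauer_le1 => //.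
by rewrite !(hornerD, hornerN, hornerZ, hornerX, hornerC); lra.
Qed.

Lemma Rintegral_deriv (p : {poly R}) :
  \int[lebesgue_measure]_(y in `[0, 1]) (p^`()).[y] = p.[1] - p.[0].
Proof.
rewrite /Rintegral (@continuous_FTC2 _ (horner p^`()) (horner p)) //.
- exact: continuous_subspaceT (@continuous_horner _ _).
- split=> [x _| | ].
  + exact: derivable_horner.
  + exact: cvg_at_right_filter (@continuous_horner _ _ _).
  + exact: cvg_at_left_filter (@continuous_horner _ _ _).
- by move=> x _; rewrite derivE.
Qed.

(** By the antiderivative, the integral of [G_(n+1)] over [[-1, 1]] is
    [(2 l - 1) (1 - (-1)^n) / ((n + 2) (n + 2 l))]; the denominator is at
    least 2 as soon as [n > 1]. *)
Lemma Rintegral_sgegenbauer_le n : (1 < n)%N ->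
  `|\int[lebesgue_measure]_(y in `[0, 1]) (sgegenbauer l n.+1).[y]| <= `|2 * l - 1|.
Proof.
move=> n1.
pose c : R := 2 * (n.+1%:R + l) * n.+2%:R * (n%:R + 2 * l).
pose F : {poly R} := (n%:R + 2 * L) * (n.+1%:R + 2 * L) * G n.+2 - n.+1%:R * n.+2%:R * G n.
have n2 : (2 : R) <= n%:R by rewrite ler_nat.
have nl1 : 1 <= n%:R + 2 * l by move: l_gt n2; lra.
have nl0 : 1 <= n%:R + 1 + l by move: l_gt n2; lra.
have c_gt0 : 0 < c.
  rewrite /c -!natr1 !mulr_gt0 ?(lt_le_trans ltr01) //; move: n2 nl0; lra.
have FE : F^`() = c *: G n.+1.
  rewrite /F -gegenbauer_antideriv -mul_polyC /c !polyCM !polyCD !polyCM !polyC_natr.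
  by [].
have Sder : sgegenbauer l n.+1 = ((2 * c)^-1 *: (F \Po (2 *: 'X - 1)))^`().
  rewrite derivZ deriv_comp FE comp_polyZ derivB derivZ derivX -[in RHS]polyC1 derivC subr0.
  rewrite alg_polyC [_ * 2%:P]mulrC mul_polyC !scalerA.
  by rewrite mulVf ?scale1r ?polyC1 // gt_eqF // mulr_gt0.
rewrite Sder Rintegral_deriv !hornerZ !horner_comp.
have -> : (2 *: 'X - 1 : {poly R}).[1] = 1.
  by rewrite !(hornerD, hornerN, hornerZ, hornerX, hornerC); ring.
have -> : (2 *: 'X - 1 : {poly R}).[0] = -1.
  by rewrite !(hornerD, hornerN, hornerZ, hornerX, hornerC); ring.
have F1 : F.[1] = (2 * l - 1) * (2 * (n.+1%:R + l)).
  rewrite /F !(horner_natr, hornerM, hornerD, hornerN, hornerX, hornerC) !gegenbauer_at1.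
  by rewrite -!natr1; ring.
have FN1 : F.[-1] = (-1) ^+ n * ((2 * l - 1) * (2 * (n.+1%:R + l))).
  rewrite /F !(horner_natr, hornerM, hornerD, hornerN, hornerX, hornerC) !gegenbauer_atN1.
  by rewrite -!natr1 !exprS; ring.
rewrite -mulrBr F1 FN1 -[X in X - _]mul1r -mulrBl.
have h2 : `|1 - (-1) ^+ n| <= 2 :> R.
  by rewrite (le_trans (ler_normB _ _)) // normr1 normr_sign; lra.
pose P : R := 2 * (n.+1%:R + l).
have P_gt0 : 0 < P by rewrite /P -natr1; move: nl0; lra.
have cP : P <= c.
  rewrite /c -/P -mulrA ler_peMr ?ltW // -!natr1.
  by move: n2 nl1; nra.
rewrite -/P; clearbody P c.
rewrite !normrM normfV (gtr0_norm P_gt0) normrM (gtr0_norm c_gt0) ger0_norm //.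
rewrite ler_pdivrMl ?mulr_gt0 // -mulrA.
rewrite mulrCA [leRHS]mulrA [leRHS]mulrC ler_wpM2l //.
by rewrite ler_pM // ltW.
Qed.

End GegenbauerTheory.

(** * Leading coefficients *)
Section LeadingCoefficient.
Context {R : realType}.
Variable l : R.
Hypothesis l_gt : - 2^-1 < l.
Local Notation G := (gegenbauer l).
Local Notation K n := (lead_coef (sgegenbauer l n)).

Lemma succDl_gt0 n : 0 < n.+1%:R + l.
Proof.
by have : (0 : R) <= n%:R by []; rewrite -natr1; move: l_gt; set a := n%:R; lra.
Qed.

Lemma gegenbauer_size_lead n :
  size (G n.+2) = n.+3 /\
  lead_coef (G n.+2) = 2 * (n.+1%:R + l) / (n.+1%:R + 2 * l) * lead_coef (G n.+1).
Proof.
have step k : size (G k.+1) = k.+2 -> size (G k) = k.+1 ->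
    size (G k.+2) = k.+3 /\
    lead_coef (G k.+2) = 2 * (k.+1%:R + l) / (k.+1%:R + 2 * l) * lead_coef (G k.+1).
  move=> s1 s0.
  have a_gt0 : 0 < 2 * (k.+1%:R + l) by rewrite mulr_gt0 // succDl_gt0.
  have b_gt0 := succD2l_gt0 l l_gt k.
  have G1nz : G k.+1 != 0 by rewrite -size_poly_gt0 s1.
  have sX : size ('X * G k.+1) = k.+3 by rewrite mulrC size_mulX // s1.
  have slt : (size (- (k.+1%:R *: G k)) < size ((2 * (k.+1%:R + l)) *: ('X * G k.+1)))%N.
    by rewrite size_polyN !size_scale ?gt_eqF // sX s0.
  rewrite gegenbauerSS; split.
    by rewrite size_scale ?invr_eq0 ?gt_eqF // size_polyDl // size_scale ?gt_eqF.
  rewrite lead_coefZ lead_coefDl // lead_coefZ (mulrC 'X) lead_coefMX.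
  by rewrite mulrA [_^-1 * _]mulrC.
suff: size (G n.+1) = n.+2 /\ size (G n) = n.+1 by case=> *; exact: step.
elim: n => [|n [IH1 IH0]]; first by rewrite /= size_polyX size_poly1.
by split=> //; have [] := step n IH1 IH0.
Qed.

Lemma lead_sgegenbauerSS n :
  K n.+2 = 4 * (n.+1%:R + l) / (n.+1%:R + 2 * l) * K n.+1.
Proof.
have sz m : size (G m) = m.+1.
  case: m => [|[|m]]; first by rewrite /= size_poly1.
    by rewrite /= size_polyX.
  by have [] := gegenbauer_size_lead m.
have lc : lead_coef (2 *: 'X - 1 : {poly R}) = 2.
  rewrite lead_coefDl; first by rewrite lead_coefZ lead_coefX mulr1.
  by rewrite size_polyN size_poly1 size_scale ?size_polyX // pnatr_eq0.
have sq : (1 < size (2 *: 'X - 1 : {poly R})%R)%N.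
  rewrite size_polyDl size_scale ?pnatr_eq0 // size_polyX //.
  by rewrite size_polyN size_poly1.
have [_ E] := gegenbauer_size_lead n.
rewrite /sgegenbauer !lead_coef_comp // lc !sz E /= exprS.
have h := succD2l_gt0 l l_gt n.
by field; rewrite nat1r; exact: lt0r_neq0.
Qed.

Lemma lead_sgegenbauer_gt0 n : 0 < K n.+1.
Proof.
elim: n => [|n IH].
  rewrite /sgegenbauer /= comp_polyX lead_coefDl.
    by rewrite lead_coefZ lead_coefX mulr1.
  by rewrite size_polyN size_poly1 size_scale ?size_polyX // pnatr_eq0.
rewrite lead_sgegenbauerSS mulr_gt0 // divr_gt0 ?succD2l_gt0 //.
by rewrite mulr_gt0 // succDl_gt0.
Qed.

(** The ratio [4 (n + l) / (n + 2 l)] of consecutive coefficients is at least 3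
    once [n >= 2 l]. *)
Lemma lead_sgegenbauer_ge : exists2 c : R, 0 < c &
  \forall n \near \oo, c * 3 ^+ n <= K n.+1.
Proof.
pose N := (Num.trunc (2 * l)).+1.
have Nl : 2 * l <= N%:R by rewrite ltW // truncnS_gt.
exists (K N.+1 / 3 ^+ N); first by rewrite divr_gt0 ?lead_sgegenbauer_gt0 ?exprn_gt0.
exists N => // n /= /subnK <-.
elim: (n - N)%N => [|m IH]; first by rewrite add0n divfK // expf_neq0 // pnatr_eq0.
rewrite addSn lead_sgegenbauerSS exprS mulrCA.
apply: ler_pM => //.
  by rewrite mulr_ge0 ?divr_ge0 ?exprn_ge0 // ltW // lead_sgegenbauer_gt0.
rewrite ler_pdivlMr ?succD2l_gt0 //.
have : (0 : R) <= m%:R by [].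
have -> : (m + N).+1%:R = m%:R + N%:R + 1 :> R by rewrite -natr1 natrD.
move: Nl l_gt; lra.
Qed.

End LeadingCoefficient.

(** * The derivative factor chi *)
Section ChiBounds.
Context {R : realType}.
Implicit Types (a l : R) (j m q k : nat).

Definition rising a m : R := \prod_(i < m) (a + i%:R).

Lemma risingS a m : rising a m.+1 = rising a m * (a + m%:R).
Proof. by rewrite /rising big_ord_recr. Qed.

Lemma rising_gt0 a m : 0 < a -> 0 < rising a m.
Proof. by move=> a0; apply: prodr_gt0 => i _; rewrite ltr_wpDr. Qed.

Lemma Gamma_rising a m : 0 < a -> Gamma (a + m%:R) = rising a m * Gamma a.
Proof.
move=> a0; elim: m => [|m IH]; first by rewrite addr0 /rising big_ord0 mul1r.
rewrite -natr1 addrA GammaS; last by rewrite ltr_wpDr.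
by rewrite IH risingS mulrCA mulrA.
Qed.

Lemma chiE l j m : - 2^-1 < l -> (0 < j)%N -> (m <= j)%N ->
  chi l j m / m`!%:R
  = 'C(j, m)%:R * rising (j%:R + 2 * l) m / rising (l + 2^-1) m.
Proof.
move=> l_gt j0 mj.
have l2 : 0 < l + 2^-1 by move: l_gt; lra.
have jl : 0 < j%:R + 2 * l.
  by have : (1 : R) <= j%:R by [rewrite ler1n]; move: l_gt; lra.
rewrite /chi natrD addrAC Gamma_rising // [m%:R + l]addrC -addrA [m%:R + _]addrC addrA.
rewrite Gamma_rising // -(bin_fact mj) !natrM.
have g1 := lt0r_neq0 (Gamma_gt0 _ l2); have g2 := lt0r_neq0 (Gamma_gt0 _ jl).
have r1 := lt0r_neq0 (rising_gt0 _ m l2).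
have f k : k`!%:R != 0 :> R by rewrite pnatr_eq0 -lt0n fact_gt0.
have := f m; have := f (j - m)%N.
move: (Gamma _) g1 (Gamma _) g2 (rising (l + _) _) r1 => x hx y hy z hz h1 h2.
by field; rewrite ?h1 ?h2 ?hx ?hy ?hz.
Qed.

Lemma rising_half_ge l q : - 2^-1 < l -> (l + 2^-1) * q`!%:R <= rising (l + 2^-1) q.+1.
Proof.
move=> l_gt; have l2 : 0 < l + 2^-1 by move: l_gt; lra.
rewrite /rising big_ord_recl /= addr0 ler_pM2l // fact_prod.
rewrite big_add1 big_mkord natr_prod.
by apply: ler_prod => i _; rewrite ler0n /= /bump /= add1n lerDr ltW.
Qed.

Lemma rising_le a b m : 0 <= a -> a <= b -> rising a m <= rising b m.
Proof.
move=> a0 ab; apply: ler_prod => i _.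
by rewrite lerD2r ab addr_ge0.
Qed.

Lemma rising_nat (N m : nat) :
  rising N.+1%:R m = 'C(N + m, m)%:R * m`!%:R :> R.
Proof.
rewrite -natrM bin_ffact.
elim: m => [|m IH]; first by rewrite /rising big_ord0 ffactn0.
by rewrite risingS IH addnS ffactSS natrM mulrC -natrD addSn.
Qed.

Lemma chi_ge0 l j m : - 2^-1 < l -> (0 < j)%N -> (m <= j)%N -> 0 <= chi l j m / m`!%:R.
Proof.
move=> l_gt j0 mj; rewrite chiE //.
have l2 : 0 < l + 2^-1 by move: l_gt; lra.
have jl : 0 < j%:R + 2 * l.
  by have : (1 : R) <= j%:R by [rewrite ler1n]; move: l_gt; lra.
by rewrite divr_ge0 ?mulr_ge0 // ltW // rising_gt0.
Qed.

(** The binomial coefficient is at most [j^(q + 1)], every factor of the rising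
    factorial in the numerator is at most a constant multiple of [j], and the
    rising factorial in the denominator is at least its first factor
    [l + 1/2]. *)
Lemma chi_le_pow l j q : - 2^-1 < l -> (q.+1 <= j)%N ->
  chi l j q.+1 / q.+1`!%:R
  <= (2 + 2 * `|l|) ^+ q.+1 / (l + 2^-1) * j%:R ^+ (2 * q.+1).
Proof.
move=> l_gt qj; have j0 : (0 < j)%N by exact: leq_trans qj.
rewrite chiE //.
have l2 : 0 < l + 2^-1 by move: l_gt; lra.
have j1 : (1 : R) <= j%:R by rewrite ler1n.
have jl : 0 <= j%:R + 2 * l by move: l_gt; lra.
have binj : 'C(j, q.+1)%:R <= j%:R ^+ q.+1 :> R.
  rewrite -natrX ler_nat (leq_trans (leq_pmulr _ (fact_gt0 q.+1))) // bin_ffact.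
  rewrite ffact_prod; apply: (@leq_trans (\prod_(i < q.+1) j)).
    by apply: leq_prod => i _; exact: leq_subr.
  by rewrite prod_nat_const card_ord.
have ris : rising (j%:R + 2 * l) q.+1 <= (j%:R * (2 + 2 * `|l|)) ^+ q.+1.
  rewrite -[X in _ <= _ ^+ X]card_ord -prodr_const; apply: ler_prod => i _.
  rewrite addr_ge0 //=.
  have : (i%:R : R) <= j%:R by rewrite ler_nat (leq_trans _ qj) // ltnW.
  by have := ler_norm l; have := normr_ge0 l; move: j1; nra.
have half : l + 2^-1 <= rising (l + 2^-1) q.+1.
  rewrite (le_trans _ (rising_half_ge _ _ l_gt)) // ler_peMr ?(ltW l2) //.
  by rewrite ler1n fact_gt0.
rewrite ler_pdivrMr ?rising_gt0 //.
apply: (@le_trans _ _ (j%:R ^+ q.+1 * (j%:R * (2 + 2 * `|l|)) ^+ q.+1)).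
  by rewrite ler_pM //; apply: prodr_ge0 => i _; rewrite addr_ge0.
have -> : j%:R ^+ q.+1 * (j%:R * (2 + 2 * `|l|)) ^+ q.+1
   = (2 + 2 * `|l|) ^+ q.+1 / (l + 2^-1) * j%:R ^+ (2 * q.+1) * (l + 2^-1).
  rewrite mulrAC divfK ?gt_eqF // mul2n -addnn exprD exprMn; ring.
by rewrite ler_wpM2l // !mulr_ge0 ?exprn_ge0 ?invr_ge0 ?(ltW l2).
Qed.

(** One term of the binomial theorem; taking [b] larger than [a] sharpens the
    estimate of the binomial coefficient when [n - m] is small. *)
Lemma bin_pow_le (n m a b : nat) : (m <= n)%N ->
  ('C(n, m) * (a ^ (n - m) * b ^ m) <= (a + b) ^ n)%N.
Proof.
move=> mn; rewrite expnDn.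
by rewrite (bigD1 (Ordinal (mn : (m < n.+1)%N))) //= leq_addr.
Qed.

(** Put [k = j - (q + 1)], so that [k <= q / 50].  The quotient of rising
    factorials is, up to a factor [O(q)], at most [2^(j + q)], that is
    [4^q 2^k]; the remaining binomial coefficient, with lower index close to
    the upper one, is at most [(11/10)^(q + 1) 11^k].  Together the powers of
    index [k] give [22^k <= (11/10)^q], whence the rate
    [4 (11/10)^2 = 121/25]. *)
Lemma chi_le_geom l : - 2^-1 < l -> exists2 C : R, 0 < C &
  forall j q, (q.+1 <= j)%N -> (50 * (j - q.+1) <= q)%N ->
  chi l j q.+1 / q.+1`!%:R <= C * q.+1%:R * (121 / 25) ^+ q.
Proof.
move=> l_gt; have l2 : 0 < l + 2^-1 by move: l_gt; lra.
pose N := Num.trunc (2 * l).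
have Nl : 2 * l <= N.+1%:R by rewrite ltW // truncnS_gt.
exists (2 ^+ N * (22 / 5) / (l + 2^-1)).
  by rewrite divr_gt0 // mulr_gt0 ?exprn_gt0 // divr_gt0.
move=> j q qj; set k := (j - q.+1)%N => kq.
have j0 : (0 < j)%N by exact: leq_trans qj.
have jE : j = (q.+1 + k)%N by rewrite subnKC.
have j1 : (1 : R) <= j%:R by rewrite ler1n.
have jl : 0 <= j%:R + 2 * l by move: l_gt; lra.
rewrite chiE //.
have bin1 : 'C(j, q.+1)%:R <= (11 / 10) ^+ q.+1 * 11 ^+ k :> R.
  rewrite expr_div_n mulrAC -exprD -jE ler_pdivlMr ?exprn_gt0 //.
  rewrite -!natrX -natrM ler_nat.
  by have := bin_pow_le _ _ 1 10 qj; rewrite exp1n mul1n.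
have ris : rising (j%:R + 2 * l) q.+1 <= 2 ^+ (j + N + q.+1) * q.+1`!%:R.
  apply: (@le_trans _ _ (rising (j + N).+1%:R q.+1)).
    by apply: rising_le => //; rewrite -addnS natrD lerD2l.
  rewrite rising_nat ler_wpM2r // -natrX ler_nat.
  have := bin_pow_le _ _ 1 1 (leq_addl (j + N) q.+1).
  by rewrite !exp1n !muln1.
have half := rising_half_ge _ q l_gt.
have k22 : 22 ^+ k <= (11 / 10) ^+ q :> R.
  (* [22 <= 2^5 <= ((11/10)^10)^5] is where the proportion 1/50 comes from. *)
  have e10 : 2 <= (11 / 10) ^+ 10 :> R by rewrite !exprS expr0; lra.
  have e50 : 22 <= (11 / 10) ^+ 50 :> R.
    rewrite (_ : 50 = 10 * 5)%N // exprM (le_trans _ (lerXn2r 5 _ _ e10)) ?nnegrE //.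
    by rewrite !exprS expr0; lra.
  apply: (@le_trans _ _ ((11 / 10) ^+ (50 * k))).
    by rewrite exprM lerXn2r ?nnegrE.
  by rewrite ler_weXn2l //; lra.
have f0 : 0 < q`!%:R :> R by rewrite ltr0n fact_gt0.
rewrite ler_pdivrMr ?rising_gt0 //.
apply: (@le_trans _ _ ((11 / 10) ^+ q.+1 * 11 ^+ k * (2 ^+ (j + N + q.+1) * q.+1`!%:R))).
  by rewrite ler_pM //; apply: prodr_ge0 => i _; rewrite addr_ge0.
set B := 2 ^+ N * (22 / 5) / (l + 2^-1) * q.+1%:R * (121 / 25) ^+ q.
apply: (@le_trans _ _ (B * ((l + 2^-1) * q`!%:R))); last first.
  by rewrite ler_wpM2l // /B !mulr_ge0 ?exprn_ge0 ?invr_ge0 ?(ltW l2) ?divr_ge0.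
have -> : B * ((l + 2^-1) * q`!%:R)
   = (11 / 10) ^+ q * (2 ^+ N * (22 / 5) * q.+1%:R * q`!%:R * (22 / 5) ^+ q).
  rewrite /B (_ : 121 / 25 = 11 / 10 * (22 / 5)); last by field.
  by rewrite exprMn; field; apply: lt0r_neq0; move: l2; lra.
have -> : (11 / 10) ^+ q.+1 * 11 ^+ k * (2 ^+ (j + N + q.+1) * q.+1`!%:R)
   = 22 ^+ k * (2 ^+ N * (22 / 5) * q.+1%:R * q`!%:R * (22 / 5) ^+ q) :> R.
  rewrite factS natrM jE !exprD !exprS (_ : 22 / 5 = 11 / 10 * 2 * 2); last by field.
  by rewrite (_ : 22 = 11 * 2) ?exprMn; [ring|rewrite -natrM].
by rewrite ler_wpM2r // !mulr_ge0 ?exprn_ge0 ?divr_ge0.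
Qed.

End ChiBounds.

(** * Asymptotic estimate of the truncation error *)
Section TruncationError.
Context {R : realType}.
Implicit Types (alpha l lq t eta c : R) (j q : nat).

Lemma Theta_gt0 lq : - 2^-1 < lq -> 0 < Theta lq.
Proof.
move=> lq_gt.
have h1 : 0 < 2 * lq + 1 by move: lq_gt; lra.
have h2 : 0 < lq + 1 by move: lq_gt; lra.
by rewrite divr_gt0 ?mulr_gt0 ?sqrtr_gt0 ?mulr_gt0 ?pi_gt0 ?Gamma_gt0.
Qed.

Lemma Upsilon_ge1 lq rho q : 1 <= rho -> (0 < q)%N -> 1 <= Upsilon lq rho q.
Proof.
move=> rho1 q0; rewrite /Upsilon; case: ifPn => //; rewrite -ltNge => lq0.
have : 1 <= q%:R `^ (- lq).
  by rewrite -[leLHS](powRr0 q%:R) ler_powR ?ler1n // oppr_ge0 ltW.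
by move: rho1; nra.
Qed.

(** A single term of the exponential series of [q ln c], of degree larger than
    [a], already beats [C q^a]. *)
Lemma powR_le_geometric c a : 1 < c ->
  forall C : R, \forall q \near \oo, C * q%:R `^ a <= c ^+ q.
Proof.
move=> c1 C.
have c0 : 0 < c by exact: lt_trans c1.
have lnc : 0 < ln c by exact: ln_gt0.
pose N := (Num.trunc a).+1.
have aN : a <= N%:R by rewrite ltW // truncnS_gt.
pose d := ln c ^+ N.+1 / N.+1`!%:R.
have d0 : 0 < d by rewrite divr_gt0 ?exprn_gt0 // ltr0n fact_gt0.
near=> q.
have q1 : (1 : R) <= q%:R.
  by rewrite ler1n; near: q; exact: nbhs_infty_gt.
have qd : `|C| / d <= q%:R by near: q; exact: nbhs_infty_ger.
apply: (@le_trans _ _ (q%:R ^+ N.+1 * d)).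
  apply: (@le_trans _ _ (`|C| * q%:R ^+ N)).
    apply: (@le_trans _ _ (`|C| * q%:R `^ a)).
      by rewrite ler_wpM2r ?powR_ge0 // ler_norm.
    by rewrite ler_wpM2l // -powR_mulrn // ler_powR.
  rewrite exprS mulrAC ler_wpM2r ?exprn_ge0 //.
  by rewrite -ler_pdivrMr.
rewrite -[X in _ <= X ^+ _](lnK (c0 : c \in Num.pos)) -expRM_natl.
have h : 0 <= q%:R * ln c by rewrite mulr_ge0 // ltW.
by rewrite (le_trans _ (expR_ge1Dxn N h)) // exprMn /d mulrA lerDr.
Unshelve. all: end_near. Qed.

(** The factor [(t / alpha)^(q + 1)] is split so that a single [t / alpha] joins
    the quantities that the exponential room must absorb. *)
Lemma truncT_le alpha l lq t j q eta :
  0 < alpha < 1 -> - 2^-1 < l -> - 2^-1 < lq -> 0 <= t <= 1 -> 0 < eta < 1 ->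
  (1 < q)%N -> (q.+1 <= j)%N ->
  `|truncT alpha l lq t j q eta|
  <= eta `^ (q%:R * (1 - alpha) / alpha) * (t / alpha) ^+ q
     * (chi l j q.+1 / q.+1`!%:R
        * (`|2 * lq - 1| * (t / alpha) / lead_coef (sgegenbauer lq q.+1))).
Proof.
move=> /andP[a0 a1] l_gt lq_gt /andP[t0 t1] /andP[e0 e1] q1 qj.
have K0 := lead_sgegenbauer_gt0 _ lq_gt q.
have X0 := chi_ge0 _ _ _ l_gt (leq_trans (ltn0Sn q) qj) qj.
have I1 := Rintegral_sgegenbauer_le _ lq_gt _ q1.
have ta : 0 <= t / alpha by rewrite divr_ge0 // ltW.
have q2 : (2 : R) <= q%:R by rewrite ler_nat.
have ea : 0 <= eta `^ alpha^-1 <= 1.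
  by rewrite powR_ge0 -[leRHS](powRr0 eta) ger_powR ?e0 ?(ltW e1) // invr_ge0 ltW.
have G1 : `|(sgegenbauer (l + q.+1%:R) (j - q.+1)).[t * (1 - eta `^ alpha^-1)]| <= 1.
  have [lq1 lq0] : - 2^-1 < l + q.+1%:R /\ 0 <= l + q.+1%:R.
    by rewrite -(natr1 q); move: l_gt q2 => ? ?; split; lra.
  apply: sgegenbauer_le1 => //.
  case/andP: ea => ea0 ea1.
  by rewrite mulr_ge0 ?mulr_ile1 ?subr_ge0 // gerBl.
have E1 : eta `^ (q.+1%:R * (1 - alpha) / alpha) <= eta `^ (q%:R * (1 - alpha) / alpha).
  rewrite ger_powR ?e0 ?(ltW e1) // ler_pM2r ?invr_gt0 // ler_pM2r ?subr_gt0 //.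
  by rewrite ler_nat.
rewrite /truncT qj mulr1.
set I := \int[_]_(_ in _) _ in I1 *.
set K := lead_coef _ in K0 *.
set g := horner _ _ in G1 *.
set X := chi _ _ _ in X0 *.
have -> : (-1) ^+ q.+1 * X / (q.+1`!%:R * K) * (t / alpha) ^+ q.+1 *
  eta `^ (q.+1%:R * (1 - alpha) / alpha) * g * I
  = (-1) ^+ q.+1 * (eta `^ (q.+1%:R * (1 - alpha) / alpha) * (t / alpha) ^+ q
      * (X / q.+1`!%:R) * (t / alpha) / K) * (g * I).
  rewrite exprS [(t / alpha) ^+ q.+1]exprS invfM; ring.
set P := (t / alpha) ^+ q; set Y := X / _ in X0 *.
have P0 : 0 <= P by exact: exprn_ge0.
have KV0 : 0 <= K^-1 by rewrite invr_ge0 ltW.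
clearbody Y P K.
rewrite normrM [X in X * _]normrM normr_sign mul1r [X in X * _]ger0_norm; last first.
  by rewrite !mulr_ge0 ?powR_ge0 ?invr_ge0 ?(ltW a0) ?(ltW K0).
have -> : eta `^ (q%:R * (1 - alpha) / alpha) * P * (Y * (`|2 * lq - 1| * (t / alpha) / K))
  = eta `^ (q%:R * (1 - alpha) / alpha) * P * Y * (t / alpha) / K * `|2 * lq - 1| by ring.
apply: ler_pM => //; first by rewrite !mulr_ge0 ?powR_ge0 ?invr_ge0 ?(ltW a0) ?(ltW K0).
  by rewrite !ler_wpM2r.
rewrite normrM; apply: le_trans I1.
by rewrite ler_piMl.
Qed.

(** The only consequence of [j ~ q] that matters: the excess of [j] over [q] is
    eventually a small proportion of [q]. *)
Lemma equivalent_index_le (j : nat -> nat) :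
  (fun q => (j q)%:R / q%:R : R) @ \oo --> (1 : R) ->
  \forall q \near \oo, (50 * (j q - q.+1) <= q)%N.
Proof.
move=> /cvgrPdist_le /(_ (50^-1)) h.
near=> q.
have q0 : (0 : R) < q%:R by rewrite ltr0n; near: q; exact: nbhs_infty_gt.
have : `|1 - (j q)%:R / q%:R| <= 50^-1 :> R by near: q; apply: h.
rewrite ler_norml => /andP[h1 _].
have h2 : (j q)%:R / q%:R <= 51 / 50 :> R by move: h1; lra.
have {h1 h2} : (j q)%:R * 50 <= 51 * q%:R :> R.
  by move: h2; rewrite ler_pdivrMr // => h2; move: h2; lra.
rewrite -!natrM ler_nat => h2.
rewrite mulnBr leq_subLR mulnC (leq_trans h2) //.
by rewrite mulnS -addnA [X in (_ + X)%N]addnC -mulSn leq_addl.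
Unshelve. all: end_near. Qed.

(** Dividing by the lower bound [c 3^q] of the leading coefficient leaves
    [q (121/75)^q], and [2 = (121/75) (150/121)] with [150/121 > 1]. *)
Lemma equivalent_index_bound alpha l lq t (j : nat -> nat) :
  0 < alpha -> - 2^-1 < l -> - 2^-1 < lq -> 0 <= t ->
  (fun q => (j q)%:R / q%:R : R) @ \oo --> (1 : R) ->
  \forall q \near \oo, (q.+1 <= j q)%N ->
    chi l (j q) q.+1 / q.+1`!%:R
      * (`|2 * lq - 1| * (t / alpha) / lead_coef (sgegenbauer lq q.+1))
    <= (Theta lq)^-1 * q%:R `^ (lq - l) * 2 ^+ q.
Proof.
move=> a0 l_gt lq_gt t0 jq.
have jnear := equivalent_index_le j jq.
have [C C0 chiC] := chi_le_geom _ l_gt.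
have [c c0 Kc] := lead_sgegenbauer_ge _ lq_gt.
have Th0 := Theta_gt0 _ lq_gt.
set A := `|2 * lq - 1| * (t / alpha).
have A0 : 0 <= A by rewrite mulr_ge0 // divr_ge0 // ltW.
have r1 : 1 < 150 / 121 :> R by lra.
have geo := powR_le_geometric _ (1 + (l - lq)) r1 (2 * C * A * Theta lq / c).
near=> q => qj.
have q0 : (0 < q)%N by near: q; exact: nbhs_infty_gt.
have q1 : (1 : R) <= q%:R by rewrite ler1n.
have kq : (50 * (j q - q.+1) <= q)%N by near: q.
have Kq : c * 3 ^+ q <= lead_coef (sgegenbauer lq q.+1) by near: q.
have gq : 2 * C * A * Theta lq / c * q%:R `^ (1 + (l - lq)) <= (150 / 121) ^+ q by near: q.
have qp : 0 < q%:R `^ (lq - l) :> R by rewrite powR_gt0 // (lt_le_trans ltr01).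
have p3 : 0 < 3 ^+ q :> R by rewrite exprn_gt0.
apply: (@le_trans _ _ (C * q.+1%:R * (121 / 25) ^+ q * (A / (c * 3 ^+ q)))).
  apply: ler_pM.
  - by apply: chi_ge0 => //; exact: leq_trans qj.
  - by rewrite divr_ge0 // ltW // lead_sgegenbauer_gt0.
  - exact: chiC.
  - by rewrite ler_wpM2l // lef_pV2 // posrE ?mulr_gt0 // lead_sgegenbauer_gt0.
apply: (@le_trans _ _ (C * (2 * q%:R) * (121 / 25) ^+ q * (A / (c * 3 ^+ q)))).
  have AK : 0 <= A / (c * 3 ^+ q) by rewrite divr_ge0 // mulr_ge0 // ltW.
  rewrite ler_wpM2r //.
  rewrite ler_wpM2r ?exprn_ge0 // ler_wpM2l ?(ltW C0) // -natr1; move: q1; lra.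
have -> : C * (2 * q%:R) * (121 / 25) ^+ q * (A / (c * 3 ^+ q))
  = (Theta lq)^-1 * q%:R `^ (lq - l) * (121 / 75) ^+ q
    * (2 * C * A * Theta lq / c * q%:R `^ (1 + (l - lq))).
  rewrite (@powRD R q%:R 1 (l - lq)) ?powRr1 //; last by rewrite (gt_eqF (lt_le_trans ltr01 q1)) implybT.
  have -> : q%:R `^ (l - lq) = (q%:R `^ (lq - l))^-1 :> R by rewrite -powRN opprB.
  have -> : 121 / 75 = 121 / 25 / 3 :> R by field.
  rewrite [(121 / 25 / 3) ^+ q]expr_div_n.
  by field; rewrite !lt0r_neq0.
have -> : 2 ^+ q = (121 / 75) ^+ q * (150 / 121) ^+ q :> R.
  by rewrite -exprMn; congr (_ ^+ _); field.
rewrite mulrA ler_wpM2l // !mulr_ge0 ?exprn_ge0 ?invr_ge0 ?(ltW Th0) ?(ltW qp) //.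
Unshelve. all: end_near. Qed.

(** Here [chi] is already bounded exactly by a part of the target, so only the
    remaining factors have to be compared with [e^q]. *)
Lemma dominant_index_bound alpha lq t :
  0 < alpha -> - 2^-1 < lq -> 0 <= t ->
  \forall q \near \oo,
    `|2 * lq - 1| * (t / alpha) / lead_coef (sgegenbauer lq q.+1)
    <= expR 1 ^+ q / (Theta lq * q%:R `^ (3 / 2 - lq)).
Proof.
move=> a0 lq_gt t0.
have [c c0 Kc] := lead_sgegenbauer_ge _ lq_gt.
have Th0 := Theta_gt0 _ lq_gt.
set A := `|2 * lq - 1| * (t / alpha).
have A0 : 0 <= A by rewrite mulr_ge0 // divr_ge0 // ltW.
have r1 : 1 < expR 1 :> R by rewrite expR_gt1.
have geo := powR_le_geometric _ (3 / 2 - lq) r1 (A / c * Theta lq).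
near=> q.
have q0 : (0 < q)%N by near: q; exact: nbhs_infty_gt.
have Kq : c * 3 ^+ q <= lead_coef (sgegenbauer lq q.+1) by near: q.
have gq : A / c * Theta lq * q%:R `^ (3 / 2 - lq) <= expR 1 ^+ q by near: q.
have qp : 0 < q%:R `^ (3 / 2 - lq) :> R by rewrite powR_gt0 // ltr0n.
have Thq : 0 < Theta lq * q%:R `^ (3 / 2 - lq) by exact: mulr_gt0.
rewrite ler_pdivlMr //; apply: le_trans gq; rewrite mulrA.
rewrite ler_wpM2r ?(ltW qp) // ler_wpM2r ?(ltW Th0) // ler_wpM2l //.
rewrite lef_pV2 ?posrE ?lead_sgegenbauer_gt0 // (le_trans _ Kq) // ler_peMr ?(ltW c0) //.
by rewrite exprn_ege1 // ler1n.
Unshelve. all: end_near. Qed.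

End TruncationError.

Section Assembly.
Context {R : realType}.

Lemma truncT_bound_sim alpha l lq t (j q : nat) (eta : R) :
  0 < alpha < 1 -> - 2^-1 < l -> - 2^-1 < lq -> 0 <= t <= 1 -> 0 < eta < 1 ->
  (1 < q)%N -> (q.+1 <= j)%N ->
  chi l j q.+1 / q.+1`!%:R
      * (`|2 * lq - 1| * (t / alpha) / lead_coef (sgegenbauer lq q.+1))
    <= (Theta lq)^-1 * q%:R `^ (lq - l) * 2 ^+ q ->
  `|truncT alpha l lq t j q eta|
  <= eta `^ (q%:R * (1 - alpha) / alpha) * Upsilon lq 2 q * bound_sim 1 alpha l lq t q.
Proof.
move=> alpha01 l_gt lq_gt t01 eta01 q1 qj bnd.
have /andP[a0 _] := alpha01; have /andP[t0 _] := t01.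
have Ups : 1 <= Upsilon lq (2 : R) q by apply: Upsilon_ge1; [rewrite ler1n|exact: ltnW].
have ThV0 : 0 <= (Theta lq)^-1 by rewrite invr_ge0 ltW // Theta_gt0.
have P0 : 0 <= (t / alpha) ^+ q by rewrite exprn_ge0 // divr_ge0 // ltW.
apply: (le_trans (truncT_le _ _ _ _ _ _ _ alpha01 l_gt lq_gt t01 eta01 q1 qj)).
have e0 := powR_ge0 eta (q%:R * (1 - alpha) / alpha).
apply: (le_trans (ler_wpM2l (mulr_ge0 e0 P0) bnd)).
rewrite /bound_sim -[2 * t / alpha]mulrA [(2 * (t / alpha)) ^+ q]exprMn.
have -> : eta `^ (q%:R * (1 - alpha) / alpha) * Upsilon lq 2 q
    * (1 / Theta lq * q%:R `^ (lq - l) * (2 ^+ q * (t / alpha) ^+ q))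
  = eta `^ (q%:R * (1 - alpha) / alpha) * (t / alpha) ^+ q
    * ((Theta lq)^-1 * q%:R `^ (lq - l) * 2 ^+ q) * Upsilon lq 2 q by ring.
by rewrite ler_peMr // !mulr_ge0 ?powR_ge0 // exprn_ge0.
Qed.

(** The first factor is the constant of [chi_le_pow]; the last one compensates
    the [q]-th power of [2 q] in the denominator of [bound_gg]. *)
Definition dominant_const (q : nat) (l : R) : R :=
  (2 + 2 * `|l|) ^+ q.+1 / (l + 2^-1) * (2 * q%:R) ^+ q.

Lemma truncT_bound_gg alpha l lq t (j q : nat) (eta : R) :
  0 < alpha < 1 -> - 2^-1 < l -> - 2^-1 < lq -> 0 <= t <= 1 -> 0 < eta < 1 ->
  (1 < q)%N -> (q.+1 <= j)%N ->
  `|2 * lq - 1| * (t / alpha) / lead_coef (sgegenbauer lq q.+1)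
    <= expR 1 ^+ q / (Theta lq * q%:R `^ (3 / 2 - lq)) ->
  `|truncT alpha l lq t j q eta|
  <= eta `^ (q%:R * (1 - alpha) / alpha) * Upsilon lq 2 q
     * bound_gg (dominant_const q l) alpha lq t j q.
Proof.
move=> alpha01 l_gt lq_gt t01 eta01 q1 qj bnd.
have /andP[a0 _] := alpha01; have /andP[t0 _] := t01.
have Ups : 1 <= Upsilon lq (2 : R) q by apply: Upsilon_ge1; [rewrite ler1n|exact: ltnW].
have qn0 : (2 * q%:R : R) != 0 by rewrite mulf_neq0 ?pnatr_eq0 // -lt0n ltnW.
have Th0 := Theta_gt0 _ lq_gt.
have P0 : 0 <= (t / alpha) ^+ q by rewrite exprn_ge0 // divr_ge0 // ltW.
have Wp : 0 < Theta lq * q%:R `^ (3 / 2 - lq).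
  by apply: mulr_gt0 => //; rewrite powR_gt0 // ltr0n ltnW.
have K0 := lead_sgegenbauer_gt0 _ lq_gt q.
have l2 : 0 < l + 2^-1 by move: l_gt; lra.
apply: (le_trans (truncT_le _ _ _ _ _ _ _ alpha01 l_gt lq_gt t01 eta01 q1 qj)).
have e0 := powR_ge0 eta (q%:R * (1 - alpha) / alpha).
have chi0 := chi_ge0 _ _ _ l_gt (leq_trans (ltn0Sn q) qj) qj.
have Z0 : 0 <= `|2 * lq - 1| * (t / alpha) / lead_coef (sgegenbauer lq q.+1).
  by rewrite divr_ge0 ?mulr_ge0 ?invr_ge0 // ltW.
apply: (le_trans (ler_wpM2l (mulr_ge0 e0 P0)
  (ler_pM chi0 Z0 (chi_le_pow _ _ _ l_gt qj) bnd))).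
have -> : eta `^ (q%:R * (1 - alpha) / alpha) * Upsilon lq 2 q
     * bound_gg (dominant_const q l) alpha lq t j q
  = eta `^ (q%:R * (1 - alpha) / alpha) * (t / alpha) ^+ q
    * ((2 + 2 * `|l|) ^+ q.+1 / (l + 2^-1) * j%:R ^+ (2 * q.+1)
    * (expR 1 ^+ q / (Theta lq * q%:R `^ (3 / 2 - lq)))) * Upsilon lq 2 q.
  rewrite /bound_gg /dominant_const.
  have -> : expR 1 * t / (2 * alpha * q%:R) = expR 1 * (t / alpha) / (2 * q%:R).
    by rewrite [2 * alpha]mulrC -[alpha * 2 * _]mulrA invfM !mulrA.
  rewrite expr_div_n [(expR 1 * (t / alpha)) ^+ q]exprMn.
  have qq : (2 * q%:R) ^+ q != 0 :> R by rewrite expf_neq0.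
  move: ((2 * q%:R) ^+ q) qq (Theta lq * _) (lt0r_neq0 Wp) (l + 2^-1) (lt0r_neq0 l2) => Q qq W W0 h hn.
  by field; rewrite qq W0 hn.
rewrite ler_peMr // mulr_ge0 ?(mulr_ge0 e0) //.
have D0 : 0 <= (2 + 2 * `|l|) ^+ q.+1 / (l + 2^-1) by rewrite divr_ge0 // ltW.
by apply: mulr_ge0; [exact: mulr_ge0|rewrite divr_ge0 ?exprn_ge0 ?expR_ge0 // ltW].
Qed.

End Assembly.

Theorem theorem4p4 (R : realType) :
  exists (nu rho : R -> R) (gam : nat -> R -> R),
  (forall l : R, - 2^-1 < l -> 0 < nu l) /\
  (forall lq : R, - 2^-1 < lq -> 1 < rho lq) /\
  forall alpha l lq t : R,
    0 < alpha < 1 -> - 2^-1 < l -> - 2^-1 < lq -> 0 <= t <= 1 ->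
    (forall (n q j : nat) (eta : R),
       (j <= n)%N -> 0 < eta < 1 ->
       is_truncation_error lq q (integrand alpha l t j)
         (truncT alpha l lq t j q eta) ->
       (j < q.+1)%N ->
       truncT alpha l lq t j q eta = 0) /\
    (forall (n j : nat -> nat) (eta : nat -> R),
       (forall q, (j q <= n q)%N) -> (forall q, 0 < eta q < 1) ->
       let represented q :=
         (q.+1 <= j q)%N /\
         is_truncation_error lq q (integrand alpha l t (j q))
           (truncT alpha l lq t (j q) q (eta q)) in
       ((fun q => (j q)%:R / q%:R : R) @ \oo --> (1 : R) ->
        asymp_le_on represented
          (fun q => `|truncT alpha l lq t (j q) q (eta q)|)
          (fun q => eta q `^ (q%:R * (1 - alpha) / alpha)
                    * Upsilon lq (rho lq) q
                    * bound_sim (nu l) alpha l lq t q)) /\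
       ((fun q => (j q)%:R / q%:R : R) @ \oo --> +oo ->
        asymp_le_on represented
          (fun q => `|truncT alpha l lq t (j q) q (eta q)|)
          (fun q => eta q `^ (q%:R * (1 - alpha) / alpha)
                    * Upsilon lq (rho lq) q
                    * bound_gg (gam q l) alpha lq t (j q) q))).
Proof.
exists (fun=> 1), (fun=> 2), dominant_const.
split=> [//|]; split=> [lq _|]; first by rewrite ltr1n.
move=> alpha l lq t alpha01 l_gt lq_gt t01.
have /andP[a0 a1] := alpha01; have /andP[t0 t1] := t01.
have ta : 0 <= t / alpha by rewrite divr_ge0 // ltW.
have Th0 := Theta_gt0 _ lq_gt.
split=> [n q j eta _ _ _ jq|n j eta _ eta01 represented].
  by rewrite /truncT leqNgt ltnS -ltnS jq mulr0.
split=> jq; exists (fun=> 0); try exact: cvg_cst.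
- have bnd := equivalent_index_bound _ _ _ _ j a0 l_gt lq_gt t0 jq.
  near=> q => -[qj _].
  have q1 : (1 < q)%N by near: q; exact: nbhs_infty_gt.
  rewrite addr0 mul1r; apply: truncT_bound_sim => //.
  by move: qj; near: q.
- have bnd := dominant_index_bound _ _ _ a0 lq_gt t0.
  near=> q => -[qj _].
  have q1 : (1 < q)%N by near: q; exact: nbhs_infty_gt.
  rewrite addr0 mul1r; apply: truncT_bound_gg => //.
  by near: q.
Unshelve. all: end_near. Qed.
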